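(* Let $x$ be a feasible solution of the problem $(\mathrm{OMRP}^0_\lambda)$. Then there exists a feasible solution $(x,w)$ of the problem $(\mathrm{OMRP}_\lambda)$ such that their objective values are equal. Conversely, if $(x,w)$ is a feasible solution of $(\mathrm{OMRP}_\lambda)$, then there exists a feasible solution $x$ of $(\mathrm{OMRP}^0_\lambda)$ having the same objective value. In particular, the optimal values coincide: $\rho_\lambda=\overline{\rho}_\lambda$.
   Context: Let $\mathbf{K}=\{x\in\mathbb{R}^n : g_j(x)\ge 0,\ j=1,\ldots,\ell\}$ with $g_1,\ldots,g_\ell\in\mathbb{R}[x]=\mathbb{R}[x_1,\ldots,x_n]$. Assume $\mathbf{K}$ satisfies Putinar's property: there is $u\in\mathbb{R}[x]$ such that $\{x\in\mathbb{R}^n: u(x)\ge 0\}$ is compact and $u=\sigma_0+\sum_{j=1}^{\ell}\sigma_j g_j$ for some sums of squares of polynomials $\sigma_0,\ldots,\sigma_\ell\in\mathbb{R}[x]$. (In particular $\mathbf{K}$ is compact.) Let $f_k=p_k/q_k$, $k=1,\ldots,m$, be rational functions with $p_k,q_k\in\mathbb{R}[x]$ and $q_k>0$ on $\mathbf{K}$, and let $\lambda_1,\ldots,\lambda_m\in\mathbb{R}[x]$. For $x\in\mathbf{K}$ let $f_{(1)}(x)\ge f_{(2)}(x)\ge\cdots\ge f_{(m)}(x)$ be the values $f_1(x),\ldots,f_m(x)$ sorted in non-increasing order (with multiplicity). Problem $(\mathrm{OMRP}^0_\lambda)$: minimize $\mathrm{OM}(x)=\sum_{k=1}^m\lambda_k(x)f_{(k)}(x)$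 over $x\in\mathbf{K}$. Its optimal value is $\rho_\lambda$. Problem $(\mathrm{OMRP}_\lambda)$: minimize $\sum_{j=1}^m\lambda_j(x)\sum_{i=1}^m f_i(x)w_{ij}$ over $x\in\mathbf{K}$ and $w=(w_{ij})\in\mathbb{R}^{m\times m}$ subject to - $\sum_{j=1}^m w_{ij}=1$ for $i=1,\ldots,m$; - $\sum_{i=1}^m w_{ij}=1$ for $j=1,\ldots,m$; - $w_{ij}^2-w_{ij}=0$ for $i,j=1,\ldots,m$; - $\sum_{i=1}^m w_{ij}f_i(x)\ge\sum_{i=1}^m w_{i,j+1}f_i(x)$ for $j=1,\ldots,m-1$; - $\sum_{i=1}^m\sum_{j=1}^m w_{ij}^2\le m$. Its optimal value is $\overline{\rho}_\lambda$. *)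

(* Defs.v *)
From mathcomp Require Import all_boot all_order all_algebra.
From mathcomp Require Import all_classical all_reals all_analysis.
From mathcomp.multinomials Require Import -(notations) mpoly.
Set Implicit Arguments.
Unset Strict Implicit.
Unset Printing Implicit Defensive.
Import Order.TTheory GRing.Theory Num.Theory.
Import numFieldNormedType.Exports.
Local Open Scope classical_set_scope.
Local Open Scope ring_scope.

(* The notation {mpoly R[n]} clashes with MathComp-Analysis. *)
Notation realpoly R n := (mpoly.mpoly n R).

Definition peval (R : realType) (n : nat) (p : realpoly R n) (x : 'rV[R]_n)
  : R := mpoly.meval (fun i => x ord0 i) p.

Definition semialgebraic_set (R : realType) (n l : nat)
    (g : 'I_l -> realpoly R n) : set 'rV[R]_n :=
  [set x | forall j, 0 <= peval (g j) x].

Definition is_sos (R : realType) (n : nat) (s : realpoly R n) : Prop :=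
  exists h : seq (realpoly R n), s = \sum_(a <- h) a ^+ 2.

Definition putinar_property (R : realType) (n l : nat)
    (g : 'I_l -> realpoly R n) : Prop :=
  exists (u s0 : realpoly R n) (s : 'I_l -> realpoly R n),
    [/\ compact [set x : 'rV[R]_n | 0 <= peval u x],
        is_sos s0, forall j, is_sos (s j)
      & u = s0 + \sum_(j < l) s j * g j].

(* The infimum is taken in the extended reals, so an infeasible problem has
   optimal value +oo. *)
Definition optimal_value (R : realType) (T : Type) (feasible : set T)
    (objective : T -> R) : \bar R :=
  ereal_inf [set (objective z)%:E | z in feasible].

Definition ratfun (R : realType) (n m : nat) (p q : 'I_m -> realpoly R n)
    (i : 'I_m) (x : 'rV[R]_n) : R :=
  peval (p i) x / peval (q i) x.

(* Indices start at 0: [ordered_value p q j x] is f_(j+1)(x). *)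
Definition ordered_value (R : realType) (n m : nat)
    (p q : 'I_m -> realpoly R n) (j : 'I_m) (x : 'rV[R]_n) : R :=
  nth 0 (sort (fun a b : R => b <= a) [seq ratfun p q i x | i <- enum 'I_m]) j.

Definition OM (R : realType) (n m : nat)
    (p q lambda : 'I_m -> realpoly R n) (x : 'rV[R]_n) : R :=
  \sum_(k < m) peval (lambda k) x * ordered_value p q k x.

Definition OMRP_feasible (R : realType) (n l m : nat)
    (g : 'I_l -> realpoly R n) (p q : 'I_m -> realpoly R n)
    : set ('rV[R]_n * 'M[R]_m) :=
  [set xw : 'rV[R]_n * 'M[R]_m | let x := xw.1 in let w := xw.2 in
    semialgebraic_set g x /\
    [/\ forall i, \sum_(j < m) w i j = 1,
        forall j, \sum_(i < m) w i j = 1,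
        forall i j, w i j ^+ 2 - w i j = 0,
        forall j j' : 'I_m, nat_of_ord j' = j.+1 ->
          \sum_(i < m) w i j * ratfun p q i x
            >= \sum_(i < m) w i j' * ratfun p q i x
      & \sum_(i < m) \sum_(j < m) w i j ^+ 2 <= m%:R]].

Definition OMRP_objective (R : realType) (n m : nat)
    (p q lambda : 'I_m -> realpoly R n) (xw : 'rV[R]_n * 'M[R]_m) : R :=
  \sum_(j < m) peval (lambda j) xw.1 *
    \sum_(i < m) ratfun p q i xw.1 * xw.2 i j.

(* Main.v *)
Require Import Defs.
From mathcomp Require Import all_boot all_order all_fingroup all_algebra.
From mathcomp Require Import all_classical all_reals all_analysis.
Import Order.TTheory GRing.Theory Num.Theory.
Import numFieldNormedType.Exports.
Local Open Scope classical_set_scope.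
Local Open Scope ring_scope.

(** For fixed [x], the constraints on [w] say that [w] is a permutation matrix
    that lists the values [f_1(x), ..., f_m(x)] in non-increasing order. Indeed,
    a doubly stochastic 0/1 matrix is a permutation matrix
    ([binary_doubly_stochastic_perm]), so that column [j] of [w] selects the
    value [f_(s j)(x)] for some permutation [s] ([sum_mul_tr_perm_mx]), and the
    inequalities between consecutive columns say that [f_(s j)(x)] is
    non-increasing in [j]. A family of reals has only one non-increasing
    rearrangement, though ties may allow several permutations to produce it;
    hence column [j] always selects [f_(j)(x)] ([nth_sort_ge]), and the two
    objectives agree. Conversely a sorting permutation exists
    ([exists_sorting_perm]), so every [x] in [K] extends to a feasible pair. The
    two problems thus attain exactly the same set of objective values, and the
    infima coincide even when they are infinite or not attained. *)

Lemma exists_sorting_perm (R : realDomainType) (m : nat) (f : 'I_m -> R) :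
  exists s : {perm 'I_m}, forall j : 'I_m,
    nth 0 (sort (fun a b : R => b <= a) [seq f i | i <- enum 'I_m]) j = f (s j).
Proof.
pose v := map_tuple f (ord_tuple m).
have := permEl (perm_sort (fun a b : R => b <= a) v).
have sz : size (sort (fun a b : R => b <= a) v) == m.
  by rewrite size_sort size_tuple.
move=> /(@tuple_permP _ _ (Tuple sz) v) [s /= def_sort].
exists s => j.
rewrite -[map _ _]/(tval v) def_sort (nth_map j) ?size_enum_ord //.
by rewrite nth_ord_enum tnth_map tnth_ord_tuple.
Qed.

Lemma sorted_sort_ge (R : realDomainType) (t : seq R) :
  sorted (fun a b : R => b <= a) (sort (fun a b : R => b <= a) t).
Proof. by apply: sort_sorted => a b; apply: le_total. Qed.

(** Antisymmetry of the order makes the sorted list unique, so the values do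
    not depend on the permutation that sorts them. *)
Lemma nth_sort_ge (R : realDomainType) (m : nat) (f : 'I_m -> R)
    (s : {perm 'I_m}) :
  (forall j j' : 'I_m, nat_of_ord j' = j.+1 -> f (s j') <= f (s j)) ->
  forall j : 'I_m,
    nth 0 (sort (fun a b : R => b <= a) [seq f i | i <- enum 'I_m]) j = f (s j).
Proof.
move=> f_noninc j.
have nthE (k : 'I_m) : nth 0 [seq f (s i) | i <- enum 'I_m] k = f (s k).
  by rewrite (nth_map k) ?size_enum_ord // nth_ord_enum.
suff -> : sort (fun a b : R => b <= a) [seq f i | i <- enum 'I_m]
          = [seq f (s i) | i <- enum 'I_m].
  exact: nthE.
apply: (@sorted_eq _ (fun a b : R => b <= a)).
- by move=> b a c ba cb; apply: le_trans cb ba.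
- by move=> a b /andP[ba ab]; apply/le_anti/andP.
- exact: sorted_sort_ge.
- apply/(sortedP 0) => i; rewrite size_map size_enum_ord => lt_i1m.
  rewrite (nthE (Ordinal lt_i1m)) (nthE (Ordinal (ltnW lt_i1m))).
  exact: f_noninc.
- rewrite perm_sort (map_comp f s); apply: perm_map.
  apply: uniq_perm; rewrite ?enum_uniq //.
    by rewrite map_inj_uniq ?enum_uniq //; apply: perm_inj.
  by move=> i; rewrite mem_enum -[i](permKV s) map_f ?mem_enum.
Qed.

Lemma sum_mul_tr_perm_mx (R : pzRingType) (m : nat) (f : 'I_m -> R)
    (s : {perm 'I_m}) (j : 'I_m) :
  \sum_(i < m) f i * (perm_mx s)^T i j = f (s j).
Proof.
rewrite (bigD1 (s j)) //= big1 => [|i ne_i]; rewrite !mxE.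
  by rewrite eqxx mulr1 addr0.
by rewrite eq_sym (negPf ne_i) mulr0.
Qed.

Lemma binary_sum1_delta (R : realDomainType) (I : finType) (a : I -> R) :
  (forall i, a i ^+ 2 - a i = 0) -> \sum_i a i = 1 ->
  exists i0, forall i, a i = (i == i0)%:R.
Proof.
move=> a_bin sum_a.
have a01 i : a i = 0 \/ a i = 1.
  have /eqP := a_bin i; rewrite expr2 -{3}[a i]mulr1 -mulrBr mulf_eq0 subr_eq0.
  by case/orP => /eqP; [left | right].
have a_ge0 i : 0 <= a i by case: (a01 i) => ->.
case: (pickP (fun i => a i == 1)) => [i0 /eqP a_i0 | no1]; last first.
  have /eqP := sum_a; rewrite big1 => [|i _]; first by rewrite eq_sym oner_eq0.
  by case: (a01 i) => // /eqP; rewrite no1.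
exists i0 => i; case: eqVneq => [-> // | ne_i].
have /eqP : \sum_(k | k != i0) a k = 0.
  by move: sum_a; rewrite (bigD1 i0) //= a_i0 => /(canRL (addKr _)); rewrite addNr.
rewrite psumr_eq0 // => /allP /(_ i (mem_index_enum i)).
by rewrite ne_i => /eqP.
Qed.

(** Each column has a single entry 1, in row [c j] say. Each row also has a
    single 1, so [c] is injective, hence a permutation. *)
Lemma binary_doubly_stochastic_perm (R : realDomainType) (m : nat)
    (w : 'M[R]_m) :
  (forall i, \sum_(j < m) w i j = 1) -> (forall j, \sum_(i < m) w i j = 1) ->
  (forall i j, w i j ^+ 2 - w i j = 0) ->
  exists s : {perm 'I_m}, w = (perm_mx s)^T.
Proof.
move=> row1 col1 w_bin.
have /fin_all_exists[c wc] j : exists c, forall i, w i j = (i == c)%:R.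
  by apply: binary_sum1_delta => // i; apply: w_bin.
have /fin_all_exists[r wr] i : exists r, forall j, w i j = (j == r)%:R.
  exact: binary_sum1_delta.
have c_row j : r (c j) = j.
  have := wr (c j) j; rewrite wc eqxx.
  by case: (eqVneq j) => // _ /eqP; rewrite oner_eq0.
exists (perm (can_inj c_row)); apply/matrixP => i j.
by rewrite !mxE permE wc eq_sym.
Qed.

Lemma OMRP_feasible_sorting_perm (R : realType) (n l m : nat)
    (g : 'I_l -> realpoly R n) (p q : 'I_m -> realpoly R n)
    (x : 'rV[R]_n) (s : {perm 'I_m}) :
  semialgebraic_set g x ->
  (forall j, ordered_value p q j x = ratfun p q (s j) x) ->
  OMRP_feasible g p q (x, (perm_mx s)^T).
Proof.
move=> gx ordE.
have w_sqr i j : ((perm_mx s)^T i j : R) ^+ 2 = (perm_mx s)^T i j.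
  by rewrite !mxE; case: (_ == _); rewrite ?expr0n ?expr1n.
have w_row i : \sum_(j < m) ((perm_mx s)^T i j : R) = 1.
  rewrite (bigD1 ((s^-1)%g i)) //= big1 => [|j ne_j]; rewrite !mxE.
    by rewrite permKV eqxx addr0.
  by rewrite -(inj_eq (@perm_inj _ (s^-1)%g)) permK (negPf ne_j).
have w_val j : \sum_(i < m) (perm_mx s)^T i j * ratfun p q i x =
               ordered_value p q j x.
  rewrite ordE -(sum_mul_tr_perm_mx _ _ (fun i => ratfun p q i x)).
  by apply: eq_bigr => i _; rewrite mulrC.
split=> //; split=> //=.
- move=> j; rewrite -[RHS](sum_mul_tr_perm_mx _ _ (fun=> 1) s j).
  by apply: eq_bigr => i _; rewrite mul1r.
- by move=> i j; rewrite w_sqr subrr.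
- move=> j j' j'E; rewrite !w_val /ordered_value j'E.
  have /(sortedP 0) := sorted_sort_ge _ [seq ratfun p q i x | i <- enum 'I_m].
  by apply; rewrite size_sort size_map size_enum_ord -j'E.
- rewrite (eq_bigr (fun=> 1)) => [|i _]; first by rewrite sumr_const card_ord.
  by rewrite -[RHS](w_row i); apply: eq_bigr => j _.
Qed.

Lemma OMRP_objective_feasible (R : realType) (n l m : nat)
    (g : 'I_l -> realpoly R n) (p q lambda : 'I_m -> realpoly R n)
    (x : 'rV[R]_n) (w : 'M[R]_m) :
  OMRP_feasible g p q (x, w) ->
  OMRP_objective p q lambda (x, w) = OM p q lambda x.
Proof.
case=> _ [/= row1 col1 w_bin w_ord _].
have [s wE] := binary_doubly_stochastic_perm _ _ _ row1 col1 w_bin.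
have w_val j : \sum_(i < m) ratfun p q i x * w i j = ratfun p q (s j) x.
  by rewrite wE (sum_mul_tr_perm_mx _ _ (fun i => ratfun p q i x)).
apply: eq_bigr => j _ /=; rewrite w_val; congr (_ * _).
rewrite /ordered_value (nth_sort_ge _ _ (fun i => ratfun p q i x) s) //.
move=> k k' /w_ord; rewrite -!w_val.
by under eq_bigr do rewrite mulrC; under [leRHS]eq_bigr do rewrite mulrC.
Qed.

Theorem theorem4 (R : realType) (n l m : nat)
    (g : 'I_l -> realpoly R n) (p q lambda : 'I_m -> realpoly R n)
    (hputinar : putinar_property g)
    (hq : forall (k : 'I_m) (x : 'rV[R]_n),
       semialgebraic_set g x -> 0 < peval (q k) x) :
  [/\ forall x : 'rV[R]_n, semialgebraic_set g x ->
        exists w : 'M[R]_m, OMRP_feasible g p q (x, w) /\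
          OMRP_objective p q lambda (x, w) = OM p q lambda x,
      forall (x : 'rV[R]_n) (w : 'M[R]_m), OMRP_feasible g p q (x, w) ->
        semialgebraic_set g x /\
          OM p q lambda x = OMRP_objective p q lambda (x, w)
    & optimal_value (semialgebraic_set g) (OM p q lambda) =
      optimal_value (OMRP_feasible g p q) (OMRP_objective p q lambda)].
Proof.
have lift x : semialgebraic_set g x ->
    exists w : 'M[R]_m, OMRP_feasible g p q (x, w) /\
      OMRP_objective p q lambda (x, w) = OM p q lambda x.
  move=> gx.
  have [s sortE] := exists_sorting_perm _ _ (fun i => ratfun p q i x).
  have feas := OMRP_feasible_sorting_perm _ _ _ _ _ _ _ _ _ gx sortE.
  exists (perm_mx s)^T; split=> //.
  exact: OMRP_objective_feasible feas.
have proj x w : OMRP_feasible g p q (x, w) ->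
    semialgebraic_set g x /\
      OM p q lambda x = OMRP_objective p q lambda (x, w).
  move=> feas; split; first by case: feas.
  by rewrite (OMRP_objective_feasible _ _ _ _ _ _ _ _ _ _ feas).
split=> //; congr ereal_inf; apply/seteqP; split=> y /=.
- by move=> [x /lift[w [feas objE]] <-]; exists (x, w); rewrite ?objE.
- by move=> [[x w] /proj[gx objE] <-]; exists x; rewrite ?objE.
Qed.
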